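(* There exist an irrational rotation $(\mathbb{T},T)$ of the $1$-torus (that is, $T(x)=x+\alpha$ with $\alpha$ irrational) and a continuous map $h:\mathbb{T}\to\mathbb{T}$ such that the skew product system $(\mathbb{T}^2,T_h)$, $T_h(x,t)=\big(Tx,\,t+h(x)\big)$, satisfies the following: (1) $(\mathbb{T}^2,T_h)$ is minimal and its largest equicontinuous factor is $(\mathbb{T},T)$ (via the projection to the first coordinate); (2) there exists a set $R\subseteq\mathbb{N}$ that is a set of recurrence for $(\mathbb{T},T)$ but is not a set of recurrence for $(\mathbb{T}^2,T_h)$.
   Context: $\mathbb{N}=\{1,2,\ldots\}$ and $\mathbb{T}=\mathbb{R}/\mathbb{Z}$, with metric induced by the distance to the nearest integer; $\mathbb{T}^2$ carries the $L^1$ (sum) metric. A system $(X,T)$ is a compact metric space $(X,d_X)$ with a continuous map $T:X\to X$. It is minimal if $\{T^nx:n\in\mathbb{N}\}$ is dense in $X$ for every $x\in X$, and equicontinuous if the family $\{T^n:n\in\mathbb{N}\}$ is equicontinuous. A factor of $(X,T)$ is a system $(Y,S)$ with a continuous surjection $\pi:X\to Y$ such that $\pi\circ T=S\circ\pi$. The largest equicontinuous factor (Kronecker factor) of $(X,T)$ is the equicontinuous factor through which every equicontinuous factor of $(X,T)$ factors. A set $R\subseteq\mathbb{N}$ is a set of recurrence for $(X,T)$ if there exists $x\in X$ with $\inf_{n\in R}d_X(x,T^nx)=0$. *)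

(* Defs.v *)
From HB Require Import structures.
From mathcomp Require Import all_boot all_order all_algebra.
From mathcomp Require Import generic_quotient ring_quotient.
From mathcomp Require Import all_classical all_reals all_analysis.

Set Implicit Arguments.
Unset Strict Implicit.
Unset Printing Implicit Defensive.

Import Order.TTheory GRing.Theory Num.Theory.
Import numFieldTopology.Exports.

Local Open Scope classical_set_scope.
Local Open Scope ring_scope.

Section dist_int.
Context {R : realType}.
Implicit Types r s : R.

Definition dist_int r : R := inf [set `|r - n%:~R| | n in [set: int]].

Lemma dist_int_le r (n : int) : dist_int r <= `|r - n%:~R|.
Proof. by apply: ge_inf; [exists 0 => _ [m _ <-] | exists n]. Qed.

Lemma dist_int_attained r : exists n : int, dist_int r = `|r - n%:~R|.
Proof.
pose f := Num.floor r.
have /andP[fr rf] : f%:~R <= r < f%:~R + 1.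
  by have := floor_itv r; rewrite intrD.
have far (m : int) : Num.min `|r - f%:~R| `|r - (f + 1)%:~R| <= `|r - m%:~R|.
  rewrite ge_min; have [mf|fm] := leP m f.
    have mfR : m%:~R <= f%:~R :> R by rewrite ler_int.
    by rewrite [`|r - f%:~R|]ger0_norm ?[`|r - m%:~R|]ger0_norm
      ?subr_ge0 ?(le_trans mfR)// lerB.
  have fmR : (f + 1)%:~R <= m%:~R :> R by rewrite ler_int lezD1.
  have rf1 : r <= (f + 1)%:~R by rewrite intrD ltW.
  rewrite orbC [`|r - (f + 1)%:~R|]ler0_norm ?[`|r - m%:~R|]ler0_norm
    ?subr_le0 ?(le_trans rf1)//.
  by rewrite !opprB lerB.
have lb : Num.min `|r - f%:~R| `|r - (f + 1)%:~R| <= dist_int r.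
  by apply: lb_le_inf; [exists `|r - f%:~R|, f | move=> _ [m _ <-]].
by move: lb; rewrite /Num.min; case: ifP => _ lb;
  [exists f | exists (f + 1)]; apply/le_anti; rewrite lb dist_int_le.
Qed.

Lemma dist_int_ge0 r : 0 <= dist_int r.
Proof. by have [n ->] := dist_int_attained r. Qed.

Lemma dist_intN r : dist_int (- r) = dist_int r.
Proof.
have le s : dist_int (- s) <= dist_int s.
  have [n ->] := dist_int_attained s.
  by rewrite -normrN opprD -intrN dist_int_le.
by apply/le_anti; rewrite le -{1}(opprK r) le.
Qed.

Lemma dist_intD r s : dist_int (r + s) <= dist_int r + dist_int s.
Proof.
have [n ->] := dist_int_attained r; have [m ->] := dist_int_attained s.
rewrite (le_trans (dist_int_le _ (n + m))) // intrD opprD addrACA.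
exact: ler_normD.
Qed.

Lemma dist_int_eq0 r : (dist_int r == 0) = (r \is a Num.int).
Proof.
apply/eqP/idP => [|/intrP[n ->]].
  have [n ->] := dist_int_attained r.
  by move=> /eqP; rewrite normr_eq0 subr_eq0 => /eqP ->; exact: intr_int.
by apply/le_anti; rewrite dist_int_ge0 (le_trans (dist_int_le _ n))// subrr normr0.
Qed.

Lemma dist_intDint r s : s \is a Num.int -> dist_int (r + s) = dist_int r.
Proof.
rewrite -dist_int_eq0 => /eqP s0; apply/le_anti/andP; split.
  by rewrite (le_trans (dist_intD _ _))// s0 addr0.
by rewrite -{1}(addrK s r) (le_trans (dist_intD _ _))// dist_intN s0 addr0.
Qed.

End dist_int.

(* [Num.int_num_subdef] is the predicate underlying [_ \is a Num.int]; the
   additive group structure of the quotient comes from ring_quotient. *)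
Definition circle (R : realType) : Type :=
  Quotient.quot (GRing.ZmodClosed.clone R (@Num.int_num_subdef R) _).

Section circle.
Context {R : realType}.
Local Open Scope quotient_scope.

HB.instance Definition _ := GRing.Zmodule.on (circle R).
HB.instance Definition _ := EqQuotient.on (circle R).
HB.instance Definition _ := ZmodQuotient.on (circle R).

Definition to_circle : R -> circle R := \pi_(circle R).

Lemma to_circleD : {morph to_circle : x y / x + y}.
Proof. exact: raddfD. Qed.

Lemma to_circleB : {morph to_circle : x y / x - y}.
Proof. exact: raddfB. Qed.

Lemma to_circle_surj (a : circle R) : exists x, to_circle x = a.
Proof. by exists (repr a); rewrite /to_circle reprK. Qed.

Lemma to_circle_eq (x y : R) :
  (to_circle x == to_circle y) = (x - y \is a Num.int).
Proof. by rewrite /to_circle -[LHS]Quotient.idealrBE. Qed.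

Definition circle_dist (a b : circle R) : R := dist_int (repr (a - b)).

Lemma circle_dist_to_circle (x y : R) :
  circle_dist (to_circle x) (to_circle y) = dist_int (x - y).
Proof.
rewrite /circle_dist -to_circleB; set z := x - y.
have : repr (to_circle z) - z \is a Num.int.
  by rewrite -to_circle_eq /to_circle reprK.
by move=> /(dist_intDint z); rewrite addrC subrK.
Qed.

Lemma circle_distxx a : circle_dist a a = 0.
Proof.
have [x <-] := to_circle_surj a.
by rewrite circle_dist_to_circle subrr; apply/eqP; rewrite dist_int_eq0.
Qed.

Lemma circle_dist_positivity a b : circle_dist a b = 0 -> a = b.
Proof.
have [x <-] := to_circle_surj a; have [y <-] := to_circle_surj b.
move=> /eqP; rewrite circle_dist_to_circle dist_int_eq0 -to_circle_eq.
by move=> /eqP.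
Qed.

Lemma circle_dist_sym a b : circle_dist a b = circle_dist b a.
Proof.
have [x <-] := to_circle_surj a; have [y <-] := to_circle_surj b.
by rewrite !circle_dist_to_circle -dist_intN opprB.
Qed.

Lemma circle_dist_triangle b a c :
  circle_dist a c <= circle_dist a b + circle_dist b c.
Proof.
have [x <-] := to_circle_surj a; have [y <-] := to_circle_surj b.
have [z <-] := to_circle_surj c; rewrite !circle_dist_to_circle.
by rewrite (le_trans _ (dist_intD _ _))// addrA subrK.
Qed.

HB.instance Definition _ := @isMetric.Build R (circle R) circle_dist
  circle_distxx circle_dist_positivity circle_dist_sym circle_dist_triangle.

End circle.

(* The two-dimensional torus is a separate constant because the library's
   uniform structure on products comes from the maximum of the distances,
   whereas here the distances of the coordinates are added. *)
Definition torus2 (R : realType) : Type := (circle R * circle R)%type.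

Section torus2.
Context {R : realType}.
Implicit Types p q r : torus2 R.

HB.instance Definition _ :=
  Choice.copy (torus2 R) (circle R * circle R)%type.

Definition torus2_dist p q : R := mdist p.1 q.1 + mdist p.2 q.2.

Lemma torus2_distxx p : torus2_dist p p = 0.
Proof. by rewrite /torus2_dist !mdistxx addr0. Qed.

Lemma torus2_dist_positivity p q : torus2_dist p q = 0 -> p = q.
Proof.
move=> /eqP; rewrite paddr_eq0 ?mdist_ge0// => /andP[/eqP pq1 /eqP pq2].
by case: p q pq1 pq2 => [a b] [c d] /= /mdist_positivity -> /mdist_positivity ->.
Qed.

Lemma torus2_dist_sym p q : torus2_dist p q = torus2_dist q p.
Proof. by rewrite /torus2_dist metric_sym (metric_sym p.2). Qed.

Lemma torus2_dist_triangle q p r :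
  torus2_dist p r <= torus2_dist p q + torus2_dist q r.
Proof. by rewrite /torus2_dist addrACA lerD// metric_triangle. Qed.

HB.instance Definition _ := @isMetric.Build R (torus2 R) torus2_dist
  torus2_distxx torus2_dist_positivity torus2_dist_sym torus2_dist_triangle.

End torus2.

(* The natural numbers start at 1, so that iterates below are T^n, n >= 1. *)
Definition posnat : set nat := [set n | (0 < n)%N].

Section dynamics.
Context {R : realType}.
Implicit Types X Y Z : metricType R.

Definition is_system X (T : X -> X) : Prop :=
  compact [set: X] /\ continuous T.

Definition minimal X (T : X -> X) : Prop :=
  forall x, dense [set iter n T x | n in posnat].

(* This is [equicontinuous posnat (fun n => iter n T)] unfolded: the library's
   [equicontinuous] requires a pointed codomain. *)
Definition equicontinuous_system X (T : X -> X) : Prop :=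
  forall x (E : set (X * X)), entourage E ->
    \forall y \near x, forall n, posnat n -> E (iter n T x, iter n T y).

Definition factor_map X Y (T : X -> X) (S : Y -> Y) (pi : X -> Y) : Prop :=
  [/\ is_system S, continuous pi, set_surj [set: X] [set: Y] pi &
      pi \o T = S \o pi].

Definition largest_equicontinuous_factor X Y
    (T : X -> X) (S : Y -> Y) (pi : X -> Y) : Prop :=
  [/\ factor_map T S pi, equicontinuous_system S &
      forall Z (U : Z -> Z) (rho : X -> Z),
        factor_map T U rho -> equicontinuous_system U ->
        exists psi : Y -> Z, factor_map S U psi /\ rho = psi \o pi].

(* The infimum is taken in the extended reals, where the infimum of the empty
   set is +oo; in R it would be 0 and the empty set would be recurrent. *)
Definition set_of_recurrence X (T : X -> X) (A : set nat) : Prop :=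
  exists x : X, ereal_inf [set (mdist x (iter n T x))%:E | n in A] = 0%E.

End dynamics.

Definition rotation (R : realType) (alpha : R) (x : circle R) : circle R :=
  x + to_circle alpha.

Definition skew_product (R : realType) (T h : circle R -> circle R)
    (p : torus2 R) : torus2 R :=
  (T p.1, p.2 + h p.1).

Definition torus2_fst (R : realType) (p : torus2 R) : circle R := p.1.

(* Main.v *)
Require Import Defs.
From mathcomp Require Import all_boot all_order all_algebra.
From mathcomp Require Import all_classical all_reals all_analysis.
From mathcomp Require Import ring lra zify.

(* The angle is the Liouville number a = sum_k 1 / d_k with d_0 = 64 and
   d_(k+1) = d_k ^ 3. With G_k x = 2 dist (d_k x, Z), the map h is the sum of
   a / 2 and of the coboundaries G_k (x + a) - G_k x, so that its Birkhoff sums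
   are h_n x = n a / 2 + sum_k (G_k (x + n a) - G_k x).
   At time n = d_j all the coboundaries are small and d_j a / 2 is close to 1/2
   modulo 1: the iterate T_h ^ d_j is close to the translation by (0, 1/2),
   whereas T ^ d_j is close to the identity, and R = {d_j} separates the two
   systems.
   At time n = d_(k+1) / (2 d_k) the k-th coboundary takes values close to 1 at
   0 and to -1 at 1 / (2 d_k), and the other ones vary little between these
   points. By the intermediate value theorem, every s is therefore of the form
   h_n x - h_n 0 modulo 1 with x as close to 0 as wanted. In the limit, for all
   s, a closed invariant set M that projects onto the circle contains points p
   and p + (0, s); if M is minimal it follows that M + (0, s) = M, hence that M
   is the torus. In the same way an equicontinuous factor map identifies some p
   with p + (0, s), hence by minimality all of them. *)

Set Implicit Arguments.
Unset Strict Implicit.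
Unset Printing Implicit Defensive.

Import Order.TTheory GRing.Theory Num.Theory.
Import numFieldTopology.Exports.
Import numFieldNormedType.Exports.
Import metricType_numDomainType.

Local Open Scope classical_set_scope.
Local Open Scope ring_scope.

(** * Sequences, minimal subsets and dense orbits in metric spaces *)

Section metric.
Context {R : realType}.
Implicit Types X Y : metricType R.

Lemma metric_continuousP X Y (f : X -> Y) :
  (forall x e, 0 < e ->
    exists2 d, 0 < d & forall y, mdist x y < d -> mdist (f x) (f y) < e) ->
  continuous f.
Proof.
move=> fc x; apply/cvgrPdist_lt => e e0; apply/nbhs_mdistP.
by have [d d0 dP] := fc x e e0; exists d.
Qed.

Lemma metric_continuous_dist X Y (f : X -> Y) x e : continuous f -> 0 < e ->
  exists2 d, 0 < d & forall y, mdist x y < d -> mdist (f x) (f y) < e.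
Proof.
move=> /(_ x)/cvgrPdist_lt/(_ e) /[apply] /nbhs_mdistP[d d0 dP].
by exists d => // y xy; exact: dP.
Qed.

Lemma invS_lt (e : R) : 0 < e -> \forall k \near \oo, k.+1%:R^-1 < e.
Proof.
move=> e0; exists (Num.truncn e^-1) => // k /= ek.
rewrite -[ltRHS]invrK ltf_pV2 ?posrE ?invr_gt0//.
by rewrite (lt_le_trans (truncnS_gt _))// ler_nat ltnS.
Qed.

Lemma cvg_mdist_harmonic X (u : nat -> X) (p : X) :
  (forall k, mdist p (u k) < k.+1%:R^-1) -> u @ \oo --> p.
Proof.
move=> up; apply/cvgrPdist_lt => e e0.
by apply: filterS (invS_lt e0) => k; apply: lt_trans.
Qed.

Lemma ge_id_cvgn (phi : nat -> nat) :
  (forall k, k <= phi k)%N -> phi @ \oo --> \oo.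
Proof.
move=> kphi A [N _ NA]; exists N => // k /= Nk; apply: NA => /=.
exact: leq_trans (kphi k).
Qed.

Lemma cvg_subseq X (phi : nat -> nat) (u : nat -> X) (p : X) :
  (forall k, k <= phi k)%N -> u @ \oo --> p ->
  u (phi k) @[k --> \oo] --> p.
Proof. by move=> /ge_id_cvgn phioo up; exact: (cvg_comp _ u phioo up). Qed.

Lemma cvg_continuous X Y (f : X -> Y) (u : nat -> X) (p : X) :
  continuous f -> u @ \oo --> p -> f (u k) @[k --> \oo] --> f p.
Proof. by move=> fc up; exact: (cvg_comp u f up (fc p)). Qed.

(** Indices are chosen near a cluster point, with k <= phi k instead of strict monotonicity: [phi]
    still tends to infinity, which is enough for limits. *)
Lemma compact_subseq X (u : nat -> X) : compact [set: X] ->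
  exists2 phi, (forall k, k <= phi k)%N &
    exists p : X, u (phi k) @[k --> \oo] --> p.
Proof.
move=> cX; have [p [_ pu]] := cX (u @ \oo) _ filterT.
have sel k : exists n, (k <= n)%N /\ mdist p (u n) < k.+1%:R^-1.
  have [||y [[n /= kn <-] pn]] := pu [set u n | n in [set n | k <= n]%N]
      [set y | mdist p y < k.+1%:R^-1].
  - by exists k => // n /= kn; exists n.
  - by apply/nbhs_mdistP; exists k.+1%:R^-1; rewrite //= invr_gt0.
  by exists n.
have [phi phiP] := choice sel.
exists phi; first by move=> k; have [] := phiP k.
by exists p; apply: cvg_mdist_harmonic => k; have [] := phiP k.
Qed.

Lemma cvg_mdist0 X (u v : nat -> X) (p : X) :
  u @ \oo --> p -> (forall k, mdist (u k) (v k) < k.+1%:R^-1) ->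
  v @ \oo --> p.
Proof.
move=> up uv; apply/cvgrPdist_lt => e e0.
have e20 : 0 < e / 2 by rewrite divr_gt0.
move/cvgrPdist_lt/(_ _ e20) : up => up.
apply: filterS2 up (invS_lt e20) => k pk ke.
rewrite (le_lt_trans (metric_triangle _ (u k) _))// [e]splitr ltrD//.
exact: lt_trans ke.
Qed.

(** Zorn's lemma is applied to complements, so that the union of a chain corresponds to an
    intersection of closed sets, nonempty by compactness. The minimal set is C minus a maximal B. *)
Lemma exists_minimal_subset X (T : X -> X) (C : set X) :
  compact [set: X] -> closed C -> C !=set0 -> C `<=` T @^-1` C ->
  exists M : set X,
    [/\ closed M, M !=set0, M `<=` T @^-1` M, M `<=` C &
        forall N, closed N -> N !=set0 -> N `<=` T @^-1` N -> N `<=` M ->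
          M `<=` N].
Proof.
move=> cX clC [c0 Cc0] invC.
pose P (B : set X) :=
  [/\ closed (~` B), ~` B `<=` T @^-1` (~` B) & (C `&` ~` B) !=set0].
have [F FP totF|B [[clB invB B0] maxB]] := @Zorn_bigcup X P.
  split.
  - rewrite setC_bigcup; apply: closed_bigI => B FB.
    by have [] := FP _ FB.
  - move=> x /= Fx [B FB BTx]; have [_ invB _] := FP _ FB.
    by apply: (invB x _ BTx) => Bx; apply: Fx; exists B.
  (* The empty chain has an empty union, and C itself is nonempty. *)
  have [[B1 FB1]|F0] := pselect (F !=set0); last first.
    by exists c0; split => // -[B FB]; case: F0; exists B.
  (* The sets C minus B, for B in the chain, form a filter base; a cluster point lies in all of them
     since they are closed. *)
  have fF : ProperFilter (filter_from F (fun B => C `&` ~` B)).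
    apply: filter_from_proper; last by move=> B /FP[].
    apply: filter_from_filter; first by exists B1.
    move=> A B FA FB; have [AB|BA] := totF _ _ FA FB.
      by exists B => // x [Cx Bx]; split; split => // /AB.
    by exists A => // x [Cx Ax]; split; split => // /BA.
  have [x [_ xF]] := cX _ fF filterT.
  have xclos B : F B -> (C `&` ~` B) x.
    move=> FB; have : closed (C `&` ~` B).
      by apply: closedI => //; have [] := FP _ FB.
    by apply => U Ux; apply: xF => //; exists B.
  exists x; split; first by have [] := xclos _ FB1.
  by move=> [B FB Bx]; have [_] := xclos _ FB.
exists (C `&` ~` B); split => //.
- exact: closedI.
- by move=> x [Cx Bx]; split; [exact: invC | exact: invB].
move=> N clN [n Nn] invN NM x [_ Bx]; apply: contrapT => Nx.
(* A point of the minimal set outside N would make the complement of N strictly larger than B. *)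
apply: (maxB (~` N)).
  split; last by move=> /(_ x Nx).
  by move=> y By /NM[_]; apply.
rewrite /P setCK; split => //; exists n; split => //.
by have [] := NM _ Nn.
Qed.

Lemma minimal_dist X (T : X -> X) x y e : minimal T -> 0 < e ->
  exists2 n, (0 < n)%N & mdist y (iter n T x) < e.
Proof.
move=> minT e0; have [||z [By [n n0 nz]]] := minT x (ball y e)^°%classic.
- by exists y; apply: nbhsx_ballx.
- exact: open_interior.
by exists n => //; have := interior_subset By; rewrite ballEmdist -nz.
Qed.

Lemma closure_orbit_invariant X (T : X -> X) x : continuous T ->
  let C := closure [set iter n T x | n in posnat] in C `<=` T @^-1` C.
Proof.
move=> Tc C y Cy B /(Tc y)/Cy[_ [[n n0 <-] /= BTn]].
by exists (iter n.+1 T x); split => //; exists n.+1.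
Qed.

Lemma closed_eq_fun X Y (f g : X -> Y) : continuous f -> continuous g ->
  closed [set x | f x = g x].
Proof.
move=> fc gc x clx; apply: (@metric_hausdorff _ Y) => A B.
move=> /(fc x) fA /(gc x) gB.
have [y [/= fgy [Ay By]]] := clx _ (@filterI _ (nbhs x) _ _ _ fA gB).
by exists (f y); split => //; rewrite fgy.
Qed.

Lemma metric_cvg_unique X (u : nat -> X) (p q : X) :
  u @ \oo --> p -> u @ \oo --> q -> p = q.
Proof. by apply: cvg_unique; exact: metric_hausdorff. Qed.

(** Serves with K the set where two maps agree: one point of agreement then suffices. *)
Lemma dense_orbit X (T : X -> X) x (K : set X) : minimal T ->
  closed K -> K x -> K `<=` T @^-1` K -> K = setT.
Proof.
move=> minT clK Kx invK; rewrite -subTset => y _.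
have Kn n : K (iter n T x) by elim: n => //= n /invK.
apply: contrapT => Ky.
have [||z [/= Kz [n _ nz]]] := minT x (~` K).
- by exists y.
- exact: closed_openC.
by apply: Kz; rewrite -nz.
Qed.

End metric.

(** * The circle, the torus and rotations *)

Section torus.
Context {R : realType}.
Implicit Types (a b c : circle R) (p q : torus2 R).

Lemma dist_int_le_norm (x : R) : dist_int x <= `|x|.
Proof. by rewrite (le_trans (dist_int_le x 0))// subr0. Qed.

Lemma dist_int_lip (x y : R) : `|dist_int x - dist_int y| <= dist_int (x - y).
Proof.
have dxy (u v : R) : dist_int u <= dist_int v + dist_int (u - v).
  by rewrite (le_trans _ (dist_intD _ _))// addrC subrK.
have := dxy x y; have := dxy y x.
by rewrite -[y - x]opprB dist_intN ler_norml; lra.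
Qed.

Lemma dist_int_nat_mul (n : nat) (x : R) :
  dist_int (n%:R * x) <= n%:R * dist_int x.
Proof.
have [m xm] := dist_int_attained x.
rewrite (le_trans (dist_int_le _ (n%:Z * m)))// xm intrM -mulrBr normrM.
by rewrite ger0_norm.
Qed.

Lemma mdist_to_circle (x y : R) :
  mdist (to_circle x) (to_circle y) = dist_int (x - y).
Proof. exact: circle_dist_to_circle. Qed.

Lemma to_circle_int (x y : R) :
  x - y \is a Num.int -> to_circle x = to_circle y.
Proof. by rewrite -to_circle_eq => /eqP. Qed.

(** Choosing the lift nearest to x turns closeness on the circle into closeness on the line. *)
Lemma circle_lift (x : R) b :
  exists2 y, to_circle y = b & `|x - y| = mdist (to_circle x) b.
Proof.
have [y <-] := to_circle_surj b.
have [n xyn] := dist_int_attained (x - y).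
exists (y + n%:~R); last by rewrite mdist_to_circle xyn opprD addrA.
by apply: to_circle_int; rewrite addrAC subrr add0r intr_int.
Qed.

Lemma mdist_circleD c a b : mdist (a + c) (b + c) = mdist a b.
Proof.
have [x <-] := to_circle_surj a; have [y <-] := to_circle_surj b.
have [z <-] := to_circle_surj c.
by rewrite -!to_circleD !mdist_to_circle opprD addrACA subrr addr0.
Qed.

Lemma continuous_to_circle : continuous (@to_circle R : R -> circle R).
Proof.
move=> x; apply/cvgrPdist_lt => e e0.
apply/nbhs_ballP; exists e => // y xy.
by rewrite mdist_to_circle; exact: le_lt_trans (dist_int_le_norm _) _.
Qed.

Lemma compact_circle : compact [set: circle R].
Proof.
have -> : [set: circle R] = (@to_circle R) @` `[0, 1]%classic.
  apply/esym; rewrite -subTset => a _; have [x <-] := to_circle_surj a.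
  exists (x - (Num.floor x)%:~R).
    by have := floor_itv x; rewrite /= in_itv/= intrD; lra.
  by apply: to_circle_int; rewrite addrAC subrr add0r rpredN intr_int.
apply: continuous_compact; last exact: segment_compact.
apply: continuous_subspaceT; exact: continuous_to_circle.
Qed.

Lemma mdist_torus2 p q : mdist p q = mdist p.1 q.1 + mdist p.2 q.2.
Proof. by []. Qed.

(** The identity from the product space to the sum metric is continuous, so compactness carries over
    from the product of two circles. *)
Lemma compact_torus2 : compact [set: torus2 R].
Proof.
have -> : [set: torus2 R] =
    (fun p : circle R * circle R => p : torus2 R) @` ([set: circle R] `*` setT).
  by apply/esym; rewrite -subTset => p _; exists p.
apply: continuous_compact; last first.
  by apply: compact_setX; exact: compact_circle.
apply: continuous_subspaceT => p; apply/cvgrPdist_lt => e e0.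
have e2 : 0 < e / 2 by rewrite divr_gt0.
exists ([set a | mdist p.1 a < e / 2], [set a | mdist p.2 a < e / 2]).
  by split; apply/nbhs_mdistP; exists (e / 2).
by move=> q [/= ? ?]; rewrite mdist_torus2 [e]splitr ltrD.
Qed.

Lemma is_system_rotation (alpha : R) : is_system (rotation alpha).
Proof.
split; first exact: compact_circle.
apply: metric_continuousP => a e e0; exists e => // b.
by rewrite mdist_circleD.
Qed.

Lemma iter_rotation (alpha : R) n (x : R) :
  iter n (rotation alpha) (to_circle x) = to_circle (x + n%:R * alpha).
Proof.
elim: n => [|n IH]; first by rewrite mul0r addr0.
by rewrite iterS IH /rotation -to_circleD -natr1 mulrDl mul1r addrA.
Qed.

Lemma mdist_iter_rotation (alpha : R) n a b :
  mdist (iter n (rotation alpha) a) (iter n (rotation alpha) b) = mdist a b.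
Proof. by elim: n => //= n <-; exact: mdist_circleD. Qed.

Lemma equicontinuous_rotation (alpha : R) :
  equicontinuous_system (rotation alpha).
Proof.
move=> a E; rewrite -entourage_ballE => -[e /= e0 eE]; apply/nbhs_mdistP.
exists e => // b ab n _; apply: eE => /=.
by rewrite ballEmdist /= mdist_iter_rotation.
Qed.

Lemma continuous_torus2_fst : continuous (@torus2_fst R).
Proof.
apply: metric_continuousP => p e e0; exists e => // q.
by apply: le_lt_trans; rewrite mdist_torus2 lerDl mdist_ge0.
Qed.

(** Vertical translations are isometries that commute with every skew product. *)
Definition vshift (s : circle R) p : torus2 R := (p.1, p.2 + s).

Lemma mdist_vshift s p q : mdist (vshift s p) (vshift s q) = mdist p q.
Proof. by rewrite !mdist_torus2 mdist_circleD. Qed.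

Lemma continuous_vshift s : continuous (vshift s).
Proof.
apply: metric_continuousP => p e e0; exists e => // q.
by rewrite mdist_vshift.
Qed.

(** * Skew products over a rotation: shearing implies minimality and determines the largest
    equicontinuous factor *)

Section skew.
Variables (alpha : R) (h : circle R -> circle R).
Hypothesis hc : continuous h.
Let T := rotation alpha.
Let Th : torus2 R -> torus2 R := skew_product T h.

Lemma continuous_skew_product : continuous Th.
Proof.
apply: metric_continuousP => p e e0.
have e2 : 0 < e / 2 by rewrite divr_gt0.
have [d d0 dh] := metric_continuous_dist (p.1) hc e2.
exists (Num.min d (e / 2)) => [|q]; first by rewrite lt_min d0.
rewrite lt_min => /andP[pqd pqe].
have pq1 : mdist p.1 q.1 < d.
  by apply: le_lt_trans pqd; rewrite mdist_torus2 lerDl mdist_ge0.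
rewrite mdist_torus2 /= mdist_circleD.
have := metric_triangle (p.2 + h p.1) (q.2 + h p.1) (q.2 + h q.1).
rewrite mdist_circleD ![q.2 + _]addrC mdist_circleD => tri.
by move: (dh _ pq1) pqe tri; rewrite mdist_torus2; lra.
Qed.

Lemma is_system_skew_product : is_system Th.
Proof. by split; [exact: compact_torus2 | exact: continuous_skew_product]. Qed.

Lemma iter_skew_product_fst n p : (iter n Th p).1 = iter n T p.1.
Proof. by elim: n => //= n ->. Qed.

Lemma skew_product_vshift s p : Th (vshift s p) = vshift s (Th p).
Proof. by rewrite /Th /vshift /skew_product /= addrAC. Qed.

Lemma iter_skew_product_vshift s n p :
  iter n Th (vshift s p) = vshift s (iter n Th p).
Proof. by elim: n => //= n ->; exact: skew_product_vshift. Qed.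

Lemma factor_map_fst : factor_map Th T (@torus2_fst R).
Proof.
split => //; first exact: is_system_rotation.
- exact: continuous_torus2_fst.
- by move=> a _; exists (a, 0).
Qed.

(** The shear is exactly s, not approximately: the intermediate value theorem will provide this, and
    it makes [sheared_dist] an equality. *)
Definition shears : Prop := forall (s : circle R) (e : R), 0 < e ->
  exists a n, [/\ (0 < n)%N, mdist (0 : circle R) a < e &
    (iter n Th (a, 0)).2 = (iter n Th (0, 0)).2 + s].

(** The base map is an isometry and vertical translations commute with [Th], so the shear at time n
    is the only change in the relative position of the two points. *)
Lemma sheared_dist s a n t0 t :
  (iter n Th (a, 0)).2 = (iter n Th (0, 0)).2 + s ->
  mdist (vshift s (iter n Th (0, t0))) (iter n Th (a, t)) =
    mdist ((0, t0) : torus2 R) (a, t).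
Proof.
have tv (c u : circle R) : ((c, u) : torus2 R) = vshift u (c, 0).
  by rewrite /vshift add0r.
move=> sh; rewrite (tv 0 t0) (tv a t) !iter_skew_product_vshift.
rewrite !mdist_torus2 /= !iter_skew_product_fst mdist_iter_rotation sh.
by rewrite addrAC [_ + s + t]addrC [_ + s + t0]addrC mdist_circleD !add0r.
Qed.

(** The base orbit of a point of M approaches b; by compactness the orbit in M accumulates at a
    point over b. *)
Lemma invariant_fibre (M : set (torus2 R)) b : minimal T -> closed M ->
  M !=set0 -> M `<=` Th @^-1` M -> exists t, M (b, t).
Proof.
move=> minT clM [p Mp] invM.
have Mn n : M (iter n Th p) by elim: n => //= n /invM.
have [n nP] : {n : nat -> nat &
    forall k, mdist b (iter (n k) T p.1) < k.+1%:R^-1}.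
  apply: (@choice _ _ (fun k m => mdist b (iter m T p.1) < k.+1%:R^-1)) => k.
  have [|m _ mP] := @minimal_dist _ _ T p.1 b k.+1%:R^-1 minT.
    by rewrite invr_gt0.
  by exists m.
have [phi phik [q qP]] :=
  compact_subseq (fun k => iter (n k) Th p) compact_torus2.
exists q.2; suff -> : b = q.1.
  rewrite -surjective_pairing.
  by apply: (closed_cvg _ clM _ _ qP); apply: nearW => k; exact: Mn.
apply: (@metric_cvg_unique _ _ (fun k => iter (n (phi k)) T p.1)).
  apply: (@cvg_subseq _ _ phi (fun k => iter (n k) T p.1)) => //.
  exact: cvg_mdist_harmonic.
under eq_fun do rewrite -iter_skew_product_fst.
exact: cvg_continuous continuous_torus2_fst qP.
Qed.

(** Points of M over a tending to 0 accumulate at some q in M over 0. At the shearing times the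
    orbit of q accumulates at p, while the orbits of these points accumulate at p translated by
    s. *)
Lemma sheared_limit (M : set (torus2 R)) s : shears -> closed M ->
  M `<=` Th @^-1` M -> (forall b, exists t, M (b, t)) ->
  exists2 p, M p & M (vshift s p).
Proof.
move=> sh clM invM full.
have Mn n p : M p -> M (iter n Th p) by elim: n => //= n IH /IH /invM.
have pt k : exists w : circle R * circle R * nat,
    [/\ M w.1, mdist (0 : circle R) w.1.1 < k.+1%:R^-1 &
      (iter w.2 Th (w.1.1, 0)).2 = (iter w.2 Th (0, 0)).2 + s].
  have [|a [n [_ a0 an]]] := sh s k.+1%:R^-1; first by rewrite invr_gt0.
  by have [t Mt] := full a; exists (a, t, n).
have [w wP] := choice pt.
have [phi phik [q qP]] :=
  compact_subseq (fun k => (w k).1 : torus2 R) compact_torus2.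
have q0 : q.1 = 0.
  apply: (@metric_cvg_unique _ _ (fun k => (w (phi k)).1.1)).
    exact: cvg_continuous continuous_torus2_fst qP.
  apply: (@cvg_subseq _ _ phi (fun k => (w k).1.1)) => //.
  by apply: cvg_mdist_harmonic => k; have [] := wP k.
have Mq : M q.
  apply: (closed_cvg _ clM _ _ qP); apply: nearW => k.
  by have [] := wP (phi k).
(* The same points, reindexed so that their distance to q has an explicit bound. *)
have pt' k : exists w : circle R * circle R * nat,
    [/\ M w.1, mdist q w.1 < k.+1%:R^-1 &
      (iter w.2 Th (w.1.1, 0)).2 = (iter w.2 Th (0, 0)).2 + s].
  have /cvgrPdist_lt/(_ k.+1%:R^-1) := qP; rewrite invr_gt0 ltr0Sn => /(_ isT).
  move=> [N _ NP]; exists (w (phi N)).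
  by have [? _ ?] := wP (phi N); split => //; exact: NP (leqnn N).
have [v vP] := choice pt'.
have [chi chik [p pP]] :=
  compact_subseq (fun k => iter (v k).2 Th q) compact_torus2.
exists p.
  by apply: (closed_cvg _ clM _ _ pP); apply: nearW => k; exact: Mn.
have cv : (fun k => iter (v (chi k)).2 Th (v (chi k)).1) @ \oo --> vshift s p.
  apply: (@cvg_mdist0 _ _ (fun k => vshift s (iter (v (chi k)).2 Th q))).
    exact: cvg_continuous (@continuous_vshift s) pP.
  move=> k; have [_ vq vs] := vP (chi k).
  have := sheared_dist q.2 (v (chi k)).1.2 vs.
  rewrite -q0 -!surjective_pairing => ->.
  by rewrite (lt_le_trans vq)// lef_pV2 ?posrE// ler_nat ltnS.
apply: (closed_cvg _ clM _ _ cv); apply: nearW => k; apply: Mn.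
by have [] := vP (chi k).
Qed.

(** In the orbit closure take a minimal M. Its intersection with its preimage under [vshift s] is
    closed, invariant and, by [sheared_limit], nonempty, so it contains M; hence M contains whole
    fibres. *)
Lemma shears_minimal : shears -> minimal T -> minimal Th.
Proof.
move=> sh minT p0 O [x Ox] oO.
set S := [set iter n Th p0 | n in posnat].
suff /(_ O) : closure S x.
  by rewrite setIC; apply; exact: open_nbhs_nbhs.
have Thc := continuous_skew_product.
have [||||M [clM M0 invM MS minM]] :=
  @exists_minimal_subset _ (torus2 R) Th (closure S).
- exact: compact_torus2.
- exact: closed_closure.
- by exists (Th p0); apply: subset_closure; exists 1.
- exact: closure_orbit_invariant.
apply: MS; have full b := invariant_fibre b minT clM M0 invM.
have shiftM s : M `<=` vshift s @^-1` M.
  have [p Mp Msp] := sheared_limit s sh clM invM full.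
  suff /minM : closed (M `&` vshift s @^-1` M).
    have subM : M `&` vshift s @^-1` M `<=` M by move=> ? [].
    move=> H; apply: subset_trans (H _ _ subM) _; last by move=> ? [].
      by exists p.
    by move=> r [Mr Msr]; split; [exact: invM|
      rewrite /preimage /= -skew_product_vshift; exact: invM].
  apply: closedI => //; move/continuous_closedP: (@continuous_vshift s).
  exact.
(* The translation by x.2 - t carries the point (x.1, t) of M to x. *)
have [t Mt] := full x.1; have := shiftM (x.2 - t) _ Mt.
by rewrite /preimage/vshift/= addrC subrK -surjective_pairing.
Qed.

(** Equicontinuity keeps the images of (0, 0) and of a nearby (a, 0) close at all times, including
    those at which the points themselves differ by nearly (0, s). This gives one p where the
    identity holds; the set of such p is closed and invariant. *)
Lemma sheared_factor (Z : metricType R) (U : Z -> Z) (rho : torus2 R -> Z) s :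
  shears -> minimal Th -> factor_map Th U rho -> equicontinuous_system U ->
  forall p, rho (vshift s p) = rho p.
Proof.
move=> sh minTh [_ rhoc _ comm] eqU.
pose K := [set p | rho (vshift s p) = rho p].
suff [p Kp] : K !=set0.
  suff KT : K = setT by move=> q; have : K q by rewrite KT.
  apply: (@dense_orbit _ _ Th p) => //.
    apply: (closed_eq_fun _ rhoc) => r.
    apply: continuous_comp; last exact: rhoc.
    exact: continuous_vshift.
  have rhoTh r : rho (Th r) = U (rho r) by have /(congr1 (@^~ r)) := comm.
  by move=> r; rewrite /K/= -skew_product_vshift !rhoTh => ->.
have rhon n r : rho (iter n Th r) = iter n U (rho r).
  elim: n => // n IH; rewrite !iterS -IH.
  by have /(congr1 (@^~ (iter n Th r))) := comm.
have pt k : exists w : circle R * nat,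
    [/\ mdist (0 : circle R) w.1 < k.+1%:R^-1,
      (iter w.2 Th (w.1, 0)).2 = (iter w.2 Th (0, 0)).2 + s &
      mdist (rho (iter w.2 Th (0, 0))) (rho (iter w.2 Th (w.1, 0)))
        < k.+1%:R^-1].
  have k0 : 0 < k.+1%:R^-1 :> R by rewrite invr_gt0.
  pose E := [set zz : Z * Z | mdist zz.1 zz.2 < k.+1%:R^-1].
  have entE : entourage E.
    rewrite -entourage_ballE; exists k.+1%:R^-1 => // -[x y] /=.
    by rewrite ballEmdist.
  have /(rhoc (0, 0))/nbhs_mdistP[d /= d0 dP] := eqU (rho (0, 0)) E entE.
  (* Below d for equicontinuity, below 1 / (k + 1) to follow the shifted orbit of (0, 0). *)
  have [|a [n [n0 a0 an]]] := sh s (Num.min d k.+1%:R^-1).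
    by rewrite lt_min d0.
  move: a0; rewrite lt_min => /andP[ad ak]; exists (a, n); split => //=.
  rewrite !rhon; apply: (dP (a, 0)) => //=.
  by rewrite mdist_torus2 mdistxx addr0.
have [w wP] := choice pt.
have [phi phik [p pP]] :=
  compact_subseq (fun k => iter (w k).2 Th (0, 0)) compact_torus2.
exists p; rewrite /K /=.
have le_inv k : (phi k).+1%:R^-1 <= k.+1%:R^-1 :> R.
  by rewrite lef_pV2 ?posrE// ler_nat ltnS.
(* This sequence tends to [rho (vshift s p)] because of the shear, and to [rho p] because of
   equicontinuity. *)
apply: (@metric_cvg_unique _ _
  (fun k => rho (iter (w (phi k)).2 Th ((w (phi k)).1, 0)))).
  apply: (cvg_continuous rhoc).
  apply: (@cvg_mdist0 _ _ (fun k => vshift s (iter (w (phi k)).2 Th (0, 0)))).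
    exact: cvg_continuous (@continuous_vshift s) pP.
  move=> k; have [w0 ws _] := wP (phi k); rewrite sheared_dist// mdist_torus2.
  by rewrite /= mdistxx addr0 (lt_le_trans w0).
apply: (@cvg_mdist0 _ _ (fun k => rho (iter (w (phi k)).2 Th (0, 0)))).
  exact: cvg_continuous rhoc pP.
by move=> k; have [_ _ wr] := wP (phi k); rewrite (lt_le_trans wr).
Qed.

(** Every equicontinuous factor map is constant on vertical fibres, hence factors through the
    section a -> (a, 0). *)
Lemma shears_largest_factor : shears -> minimal Th ->
  largest_equicontinuous_factor Th T (@torus2_fst R).
Proof.
move=> sh minTh; split; [exact: factor_map_fst|exact: equicontinuous_rotation|].
move=> Z U rho rhoF eqU.
have rhos p : rho p = rho (p.1, 0).
  rewrite -[RHS](sheared_factor p.2 sh minTh rhoF eqU) /vshift add0r /=.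
  by rewrite -surjective_pairing.
have [sysU rhoc rho_surj comm] := rhoF.
exists (fun a => rho (a, 0)); split; last first.
  by apply/funext => p /=; rewrite rhos.
split => //.
- apply: metric_continuousP => a e e0.
  have [d d0 dP] := metric_continuous_dist ((a, 0) : torus2 R) rhoc e0.
  exists d => // b ab; apply: dP.
  by rewrite mdist_torus2 mdistxx addr0.
- by move=> z /rho_surj[p _ pz]; exists p.1; rewrite // -rhos.
apply/funext => a /=; rewrite [RHS]/=.
have /(congr1 (@^~ (a, 0))) /= <- := comm.
by rewrite [RHS]rhos.
Qed.
End skew.
End torus.

(** * The denominators and their growth *)

Section liouville.
Context {R : realType}.
Implicit Types (x y : R) (u : nat -> R).

Definition denom (k : nat) : nat := 64 ^ (3 ^ k).

Lemma denomS k : denom k.+1 = (denom k ^ 3)%N.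
Proof. by rewrite /denom expnSr expnM. Qed.

Lemma denom_ge k : (64 * 2 ^ k <= denom k)%N.
Proof.
elim: k => // k IH; rewrite denomS expnS.
have := leq_pmulr 64 (expn_gt0 2 k); nia.
Qed.

Lemma denom_gt0 k : (0 < denom k)%N.
Proof. by rewrite expn_gt0. Qed.

Lemma denom_homo i k : (i <= k)%N -> (denom i <= denom k)%N.
Proof. by move=> ik; rewrite !leq_exp2l. Qed.

Lemma denom_sq_le i k : (i < k)%N -> (denom i * denom i <= denom k)%N.
Proof.
move=> /denom_homo; apply: leq_trans; rewrite denomS.
by have := denom_gt0 i; nia.
Qed.

(** The factor 2 makes half of a denominator a multiple of all earlier ones, and makes
    [denom k.+1 / (2 * denom k)] an integer. *)
Lemma denom_dvd i k : (i < k)%N -> (2 * denom i %| denom k)%N.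
Proof.
move=> ik; apply: (@dvdn_trans (denom i.+1)); last first.
  by rewrite dvdn_exp2l// leq_exp2l.
rewrite denomS !expnS muln1; apply: dvdn_mul; last exact: dvdn_mulr.
by rewrite /denom -(prednK (expn_gt0 3 i)) expnS dvdn_mulr.
Qed.

Local Notation Q k := ((denom k)%:R : R).

Lemma Q_gt0 k : 0 < Q k.
Proof. by rewrite ltr0n denom_gt0. Qed.

Lemma Q_ge k : 64 * 2 ^+ k <= Q k.
Proof. by rewrite -natrX -natrM ler_nat denom_ge. Qed.

Lemma Q_ge64 k : 64 <= Q k.
Proof.
by rewrite ler_nat (leq_trans _ (denom_ge k))// leq_pmulr// expn_gt0.
Qed.

Lemma Qinv_le64 k : (Q k)^-1 <= 64^-1.
Proof. by rewrite lef_pV2 ?posrE ?Q_gt0// Q_ge64. Qed.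

Lemma Qinv_gt0 k : 0 < (Q k)^-1.
Proof. by rewrite invr_gt0 Q_gt0. Qed.

Lemma QS k : Q k.+1 = Q k ^+ 3.
Proof. by rewrite denomS natrX. Qed.

Lemma QinvS k : 2 * (Q k.+1)^-1 <= (Q k)^-1.
Proof.
rewrite -ler_pdivlMl// -invfM lef_pV2 ?posrE ?mulr_gt0 ?Q_gt0// QS.
by have := Q_ge64 k; nra.
Qed.

Lemma Qinv_small (e : R) : 0 < e -> exists k, (Q k)^-1 < e.
Proof.
move=> /invS_lt[k _ /(_ k (leqnn k)) /= ke]; exists k; apply: le_lt_trans ke.
rewrite lef_pV2 ?posrE ?Q_gt0// ler_nat (leq_trans _ (denom_ge k))//.
by rewrite (leq_trans (ltn_expl k (ltnSn 1)))// leq_pmull.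
Qed.

(** * Series dominated by the inverses of the denominators *)

Section series.
Variables (C : R) (u : nat -> R).
Hypothesis uC : forall k, `|u k| <= C * (Q k)^-1.

Lemma Qseries_partial N m :
  `|series u (N + m)%N - series u N| <= 2 * C * (Q N)^-1.
Proof.
have C0 : 0 <= C.
  by have := le_trans (normr_ge0 _) (uC 0); rewrite pmulr_lge0 ?Qinv_gt0.
(* The subtracted term makes the induction go through: twice the next inverse is at most the current
   one. *)
suff : `|series u (N + m)%N - series u N| <=
    2 * C * (Q N)^-1 - 2 * C * (Q (N + m))^-1.
  by move/le_trans; apply; rewrite gerBl !mulr_ge0// ltW ?Qinv_gt0.
elim: m => [|m IH]; first by rewrite addn0 !subrr normr0.
rewrite addnS seriesSr addrAC (le_trans (ler_normD _ _))//.
have := uC (N + m); have := QinvS (N + m).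
move: IH; move: (Q (N + m))^-1 (Q (N + m).+1)^-1 => a b.
by nra.
Qed.

Lemma is_cvg_Qseries : cvgn (series u).
Proof.
have C0 : 0 <= C.
  by have := le_trans (normr_ge0 _) (uC 0); rewrite pmulr_lge0 ?Qinv_gt0.
apply: normed_cvg; apply: (@series_le_cvg _ _ (geometric C 2^-1)) => //.
- by move=> k; exact: normr_ge0.
- by move=> k; rewrite /= mulr_ge0// exprn_ge0.
- move=> k; rewrite (le_trans (uC k))// /geometric /= ler_wpM2l// exprVn.
  rewrite lef_pV2 ?posrE ?Q_gt0 ?exprn_gt0// (le_trans _ (Q_ge k))//.
  by rewrite ler_peMl ?exprn_ge0// ler1n.
by apply: is_cvg_geometric_series; rewrite ger0_norm// invf_lt1// ltr1n.
Qed.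

Lemma Qseries_tail N : `|limn (series u) - series u N| <= 2 * C * (Q N)^-1.
Proof.
have near_le : \forall n \near \oo,
    `|series u n - series u N| <= 2 * C * (Q N)^-1.
  by exists N => // n /= Nn; rewrite -(subnKC Nn) Qseries_partial.
rewrite ler_norml lerBDr lerBDl; apply/andP; split.
  apply: limr_ge; first exact: is_cvg_Qseries.
  by apply: filterS near_le => n; rewrite ler_norml; lra.
apply: limr_le; first exact: is_cvg_Qseries.
by apply: filterS near_le => n; rewrite ler_norml; lra.
Qed.

(** The tail bound at N = 0, where the denominator is 64. *)
Lemma Qseries_le : `|limn (series u)| <= C / 32.
Proof.
have := Qseries_tail 0; rewrite /series /= big_geq// subr0.
by rewrite /denom expn0 expn1; lra.
Qed.

End series.

(** * The Liouville angle and the minimality of its rotation *)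

Definition angle : R := limn (series (fun k => (Q k)^-1)).

(* [1 / 2] because the partial sum ending with the term [1 / denom k] is an
   odd multiple of [1 / denom k]. *)
Lemma half_denom_angle k : exists (m : int) (e : R),
  [/\ Q k / 2 * angle = m%:~R + 2^-1 + e, 0 < e & e <= (Q k)^-1 ^+ 2].
Proof.
pose S := series (fun k => (Q k)^-1).
have u1 i : `|(Q i)^-1| <= 1 * (Q i)^-1.
  by rewrite mul1r ger0_norm// ltW ?Qinv_gt0.
(* [S k] stops before the term of index k, and all its denominators divide half of [denom k]. *)
have Sint : Q k / 2 * S k \is a Num.int.
  rewrite /S /series /= mulr_sumr big_nat; apply: rpred_sum => i /= ik.
  have /dvdnP[c ->] := denom_dvd ik.
  rewrite !natrM (_ : _ * _ = c%:R) ?rpred_nat//.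
  by field; rewrite lt0r_neq0// Q_gt0.
have Slow : S k.+2 <= angle.
  apply: limr_ge; first exact: is_cvg_Qseries u1.
  exists k.+2 => // n /= kn; rewrite /S -(subnKC kn).
  elim: (n - k.+2)%N => [|j IH]; first by rewrite addn0.
  by rewrite addnS [leRHS]seriesSr (le_trans IH)// lerDl ltW ?Qinv_gt0.
have := Qseries_tail u1 k.+1; rewrite -/angle -/S ler_norml mulr1.
have := Qinv_gt0 k.+1; have := Q_gt0 k.
have /intrP[m km] := Sint.
exists m, (Q k / 2 * (angle - S k.+1)); split.
- rewrite -km mulrBr {2}/S seriesSr -/S mulrDr.
  by field; rewrite lt0r_neq0 ?Q_gt0.
- by move: Slow; rewrite /S seriesSr; nra.
(* The tail after index k is at most 2 / d_(k+1); multiplied by d_k / 2 it is at most d_k /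
   d_(k+1). *)
have : (Q k) * (Q k.+1)^-1 = (Q k)^-1 ^+ 2.
  by rewrite QS; field; rewrite lt0r_neq0 ?Q_gt0.
by nra.
Qed.

Lemma denom_angle k : exists (m : int) (e : R),
  [/\ Q k * angle = m%:~R + e, 0 < e & e <= 2 * (Q k)^-1 ^+ 2].
Proof.
have [m [e [mE e0 el]]] := half_denom_angle k.
exists (2 * m + 1), (2 * e); split; [|lra|lra].
by rewrite intrD intrM; lra.
Qed.

Lemma Qinv_sq k : (Q k)^-1 ^+ 2 <= (Q k)^-1 / 64.
Proof. by have := Qinv_le64 k; have := Qinv_gt0 k; nra. Qed.

Lemma dist_int_denom_angle k : dist_int (Q k * angle) <= 2 * (Q k)^-1 ^+ 2.
Proof.
have [m [e [-> e0 el]]] := denom_angle k.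
rewrite addrC dist_intDint ?intr_int// (le_trans (dist_int_le_norm _))//.
by rewrite gtr0_norm.
Qed.

(** If c times the angle were an integer, so would be c * e, where e is the error in [denom_angle];
    but 0 < c * e < 1 once c < d_k. *)
Lemma irrational_angle : irrational angle.
Proof.
move=> /rationalP[a [b ab]].
have [c c0 /intrP[m cm]] :
    exists2 c : nat, (0 < c)%N & c%:R * angle \is a Num.int.
  (* For b = 0 the quotient is 0 by convention, and c = 1 works. *)
  have [b0|b0] := posnP b.
    by exists 1%N => //; rewrite ab b0 invr0 !mulr0; exact: rpred0.
  exists b => //; rewrite ab mulrC divfK ?intr_int// pnatr_eq0.
  by rewrite -lt0n.
have [k kc] : exists k, (Q k)^-1 < c%:R^-1.
  by apply: Qinv_small; rewrite invr_gt0 ltr0n.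
have [l [e [le e0 el]]] := denom_angle k.
have ce : c%:R * e = (Q k * m%:~R - c%:R * l%:~R).
  by rewrite -cm mulrCA le; ring.
have c0' : 0 < c%:R :> R by rewrite ltr0n.
have ce1 : c%:R * e < 1.
  have cQ : c%:R * (Q k)^-1 < 1 by rewrite -ltr_pdivlMl// mulr1.
  by have := Qinv_le64 k; have := Qinv_gt0 k; nra.
have ce0 : 0 < c%:R * e by rewrite mulr_gt0.
move: ce1 ce0; rewrite ce -[Q k]/((denom k)%:Z%:~R) -[c%:R]/(c%:Z%:~R).
rewrite -!intrM -intrB ltr0z -[1]/(1%:~R) ltr_int; lia.
Qed.

(** Modulo 1, d_k steps of the rotation advance by a small d > 0, and multiples of d come within d
    of any target. *)
Lemma angle_dense x (e : R) : 0 < e ->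
  exists2 n, (0 < n)%N & dist_int (x - n%:R * angle) < e.
Proof.
move=> e0; have [k ke] := Qinv_small e0.
have [m [d [md d0 dl]]] := denom_angle k.
have [de d1] : d < e /\ d < 1.
  by have := Qinv_sq k; have := Qinv_le64 k; have := Qinv_gt0 k; split; nra.
(* Adding 1 to the fractional part gives r >= 1 > d, so that the number of steps is positive. *)
pose r := x - (Num.floor x)%:~R + 1.
have r1 : 1 <= r by have := floor_itv x; rewrite /r; lra.
have rd0 : 0 <= r / d by rewrite divr_ge0//; lra.
pose n := Num.truncn (r / d).
have /andP[nlo nhi] := truncn_itv rd0; rewrite -/n in nlo nhi.
have n0 : (0 < n)%N.
  by rewrite /n truncn_gt0 ler_pdivlMr// mul1r; lra.
exists (n * denom k)%N; first by rewrite muln_gt0 n0 denom_gt0.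
rewrite natrM -mulrA md.
have -> : x - n%:R * (m%:~R + d) =
    r - n%:R * d + ((Num.floor x)%:~R - 1 - n%:R * m%:~R) by rewrite /r; ring.
rewrite dist_intDint; last first.
  by rewrite !rpredB ?rpredM ?intr_int ?rpred1 ?rpred_nat.
rewrite (le_lt_trans (dist_int_le_norm _))//.
move: nlo nhi; rewrite ler_pdivlMr// ltr_pdivrMr// -natr1 mulrDl mul1r => lo hi.
by rewrite ger0_norm; lra.
Qed.

Lemma minimal_rotation : minimal (rotation angle).
Proof.
move=> a O [b Ob] oO.
have /nbhs_mdistP[e /= e0 eO] : nbhs b O by exact: open_nbhs_nbhs.
have [x xa] := to_circle_surj a; have [y yb] := to_circle_surj b.
have [n n0 ne] := angle_dense (y - x) e0.
exists (iter n (rotation angle) a); split; last by exists n.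
apply: eO => /=; rewrite -xa -yb iter_rotation mdist_to_circle.
by rewrite opprD addrA.
Qed.

(** * Triangle waves, their coboundaries and the cocycle *)

Definition wave k x : R := 2 * dist_int (Q k * x).

Definition coboundary y x k : R := wave k (x + y) - wave k x.

(** Formally the increment of the sum of all waves, which need not converge; the series of
    increments converges when y is a natural multiple of the angle. *)
Definition transfer y x : R := limn (series (coboundary y x)).

Lemma wave_lip k x y : `|wave k x - wave k y| <= 2 * dist_int (Q k * (x - y)).
Proof.
rewrite /wave -mulrBr normrM ger0_norm// ler_pM2l// mulrBr.
exact: dist_int_lip.
Qed.

Lemma coboundary_le y x k : `|coboundary y x k| <= 2 * dist_int (Q k * y).
Proof. by rewrite (le_trans (wave_lip _ _ _))// addrAC subrr add0r. Qed.

Lemma coboundary_nat n x k :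
  `|coboundary (n%:R * angle) x k| <= n%:R * (Q k)^-1.
Proof.
rewrite (le_trans (coboundary_le _ _ _))// mulrCA.
have := dist_int_nat_mul n (Q k * angle).
have := dist_int_denom_angle k; have := Qinv_sq k; have := Qinv_gt0 k.
have : 0 <= n%:R :> R by [].
by move: (n%:R : R) (Q k)^-1 => N b; nra.
Qed.

Lemma transfer0 x : transfer 0 x = 0.
Proof.
rewrite /transfer (_ : series _ = fun=> 0) ?lim_cst//.
apply/funext => n; rewrite /series /= big1// => k _.
by rewrite /coboundary addr0 subrr.
Qed.

(** Termwise, the increment over n + 1 steps splits at x + n * [angle]. *)
Lemma transferS n x : transfer (n.+1%:R * angle) x =
  transfer (n%:R * angle) x + transfer angle (x + n%:R * angle).
Proof.
have c1 z : cvgn (series (coboundary angle z)).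
  rewrite -[X in coboundary X]mul1r.
  exact: is_cvg_Qseries (coboundary_nat 1 z).
rewrite -[RHS]lim_seriesD//; last first.
  exact: is_cvg_Qseries (coboundary_nat n x).
congr (limn (series _)); apply/funext => k; rewrite /coboundary/= fctE /=.
by rewrite -natr1 mulrDl mul1r addrA; ring.
Qed.

Lemma transfer_int y x z : x - z \is a Num.int -> transfer y x = transfer y z.
Proof.
move=> xz; congr (limn (series _)); apply/funext => k.
have w t : wave k (x + t) = wave k (z + t).
  rewrite /wave; have -> : x + t = (z + t) + (x - z) by ring.
  by rewrite mulrDr dist_intDint// rpredM// rpred_nat.
by rewrite /coboundary w -[x]addr0 w addr0.
Qed.

(** Partial sums are Lipschitz, and the tails are small uniformly in the point. *)
Lemma transfer_unif_continuous n (e : R) : 0 < e -> exists2 d : R, 0 < d &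
  forall x z, `|x - z| < d ->
    `|transfer (n%:R * angle) x - transfer (n%:R * angle) z| < e.
Proof.
move=> e0; set y := n%:R * angle.
have lip N : exists2 L : R, 0 <= L & forall x z,
    `|series (coboundary y x) N - series (coboundary y z) N| <= L * `|x - z|.
  elim: N => [|N [L L0 LP]].
    by exists 0 => // x z; rewrite /series /= !big_geq// subrr normr0 mul0r.
  (* The wave of index N has Lipschitz constant 2 * Q N and occurs twice. *)
  exists (L + 4 * Q N) => [|x z]; first by rewrite addr_ge0.
  rewrite !seriesSr opprD addrACA (le_trans (ler_normD _ _))// mulrDl lerD//.
  have cob : coboundary y x N - coboundary y z N =
    (wave N (x + y) - wave N (z + y)) - (wave N x - wave N z).
    by rewrite /coboundary; ring.
  rewrite cob (le_trans (ler_normB _ _))//.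
  have := wave_lip N x z; have := wave_lip N (x + y) (z + y).
  rewrite (_ : x + y - (z + y) = x - z); last by ring.
  have := dist_int_le_norm (Q N * (x - z)); rewrite normrM normr_nat; lra.
(* Each of the two tails is then below e / 4; n.+1 avoids a zero divisor. *)
have [N Ne] : exists N, (Q N)^-1 < e / (8 * n.+1%:R).
  by apply: Qinv_small; rewrite divr_gt0.
have [L L0 LP] := lip N; exists (e / (2 * (L + 1))) => [|x z xz].
  by rewrite divr_gt0// mulr_gt0//; lra.
have tx := Qseries_tail (coboundary_nat n x) N.
have tz := Qseries_tail (coboundary_nat n z) N.
rewrite -/y -/(transfer y x) in tx; rewrite -/y -/(transfer y z) in tz.
have Lxz := LP x z.
have Le : L * `|x - z| <= e / 2.
  have L1 : 0 < 2 * (L + 1) by lra.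
  move: xz; rewrite ltr_pdivlMr//; have := normr_ge0 (x - z); nra.
have ne : 2 * n%:R * (Q N)^-1 < e / 4.
  move: Ne; rewrite ltr_pdivlMr// -(natr1 n); have := Qinv_gt0 N; lra.
move: tx tz Lxz; rewrite !ler_norml ltr_norml.
move=> /andP[? ?] /andP[? ?] /andP[? ?]; apply/andP; split; lra.
Qed.

Definition cocycle x : R := angle / 2 + transfer angle x.

(** Closed form of the Birkhoff sums of [cocycle], as the recurrence [cocycle_sumS] shows. *)
Definition cocycle_sum n x : R := n%:R * angle / 2 + transfer (n%:R * angle) x.

Lemma cocycle_sum0 x : cocycle_sum 0 x = 0.
Proof. by rewrite /cocycle_sum !mul0r transfer0 addr0. Qed.

Lemma cocycle_sumS n x :
  cocycle_sum n.+1 x = cocycle_sum n x + cocycle (x + n%:R * angle).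
Proof. by rewrite /cocycle_sum /cocycle transferS -natr1; ring. Qed.

Lemma continuous_cocycle_sum n : continuous (cocycle_sum n).
Proof.
move=> x; apply/(@pseudometric_normed_Zmodule.cvgrPdist_lt _ R) => e e0.
have [d d0 dP] := transfer_unif_continuous n e0.
apply/nbhs_ballP; exists d => // z xz.
by rewrite /cocycle_sum opprD addrACA subrr add0r; exact: dP.
Qed.

(** Modulo 1, the drift d_j * [angle] / 2 is 1/2 plus at most 1/64, and the coboundaries add at most
    1/8 in absolute value. *)
Lemma cocycle_sum_denom j x : 4^-1 <= dist_int (cocycle_sum (denom j) x).
Proof.
have tr : `|transfer (Q j * angle) x| <= 4 / 32.
  apply: Qseries_le => k; rewrite (le_trans (coboundary_le _ _ _))//.
  (* The smaller of d_j, d_k is pulled out of the distance: times the larger one, d, the angle is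
     within 2 / d^2 of an integer, so each term is at most 4 / d. *)
  have [kj|jk] := leqP k j.
    have := dist_int_nat_mul (denom k) (Q j * angle).
    have := dist_int_denom_angle j; have := denom_homo kj; rewrite -(ler_nat R).
    have : Q j * (Q j)^-1 = 1 by rewrite divff// lt0r_neq0// Q_gt0.
    have : Q k * (Q k)^-1 = 1 by rewrite divff// lt0r_neq0// Q_gt0.
    have := Q_gt0 k; have := Q_gt0 j.
    have := Qinv_gt0 k; have := Qinv_gt0 j.
    move: (dist_int (Q k * _)) (dist_int (Q j * _)) => d' d.
    move: (Q k) (Q j) (Q k)^-1 (Q j)^-1 => a b a' b'.
    move=> a'0 b'0 a0 b0 aa bb ab d1 d2.
    have ba' : b' <= a' by nra.
    have : a * b' <= 1 by nra.
    by nra.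
  rewrite mulrCA; have := dist_int_nat_mul (denom j) (Q k * angle).
  have := dist_int_denom_angle k.
  have := denom_homo (ltnW jk); rewrite -(ler_nat R).
  have : Q k * (Q k)^-1 = 1 by rewrite divff// lt0r_neq0// Q_gt0.
  have := Q_gt0 j; have := Qinv_gt0 k.
  move: (dist_int (Q j * _)) (dist_int (Q k * _)) => d' d.
  move: (Q k) (Q j) (Q k)^-1 => a b a'.
  move=> a'0 b0 aa ba d1 d2.
  have ba1 : b * a' <= 1 by nra.
  have : b * d <= b * (2 * a' ^+ 2) by rewrite ler_wpM2l// ltW.
  by nra.
have [m [e [me e0 el]]] := half_denom_angle j.
have [l lE] := dist_int_attained (cocycle_sum (denom j) x); rewrite lE.
have e1 : e <= 64^-1.
  by have := Qinv_sq j; have := Qinv_le64 j; lra.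
have -> : cocycle_sum (denom j) x - l%:~R =
    (m - l)%:~R + (2^-1 + e + transfer (Q j * angle) x).
  by rewrite /cocycle_sum mulrAC me intrB; ring.
have [ml|ml] := leP 0 (m - l).
  have : 0 <= (m - l)%:~R :> R by rewrite ler0z.
  by move: tr; rewrite ler_norml => /andP[? ?] ?; rewrite ger0_norm; lra.
have : (m - l)%:~R <= -1 :> R by rewrite -[-1]/((-1)%:~R) ler_int; lia.
by move: tr; rewrite ler_norml => /andP[? ?] ?; rewrite ler0_norm; lra.
Qed.

(** * Oscillation of the Birkhoff sums at the shearing times *)

Lemma dist_int_half : dist_int (2^-1 : R) = 2^-1.
Proof.
apply/le_anti/andP; split.
  by rewrite (le_trans (dist_int_le_norm _))// ger0_norm// invr_ge0.
have [m ->] := dist_int_attained (2^-1 : R).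
have [m0|m1] := leP m 0.
  have : m%:~R <= 0 :> R by rewrite lerz0.
  by move=> ?; rewrite ger0_norm; lra.
have : 1 <= m%:~R :> R by rewrite -[1]/(1%:~R) ler_int; lia.
by move=> ?; rewrite ler0_norm; lra.
Qed.

(** With n = d_(k+1) / (2 d_k), d_k n [angle] is nearly 1/2 modulo 1, so the k-th terms at the two
    points differ by about 2; all the errors together are at most 4/32. *)
Lemma cocycle_sum_oscillates k : exists2 n, (0 < n)%N &
  1 <= cocycle_sum n 0 - cocycle_sum n (2 * Q k)^-1.
Proof.
have /dvdnP[n qn] := denom_dvd (ltnSn k).
have Qn : Q k.+1 = n%:R * (2 * Q k) by rewrite qn !natrM.
exists n; first by have := denom_gt0 k.+1; rewrite qn; case: (n).
set z := (2 * Q k)^-1; set y := n%:R * angle.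
have Qk0 : Q k != 0 by rewrite lt0r_neq0 ?Q_gt0.
have [m [e [me e0 el]]] := half_denom_angle k.+1.
have Qky : Q k * y = m%:~R + 2^-1 + e by rewrite -me Qn /y; field.
have Qkz : Q k * z = 2^-1 by rewrite /z; field.
pose v i := coboundary y 0 i - coboundary y z i.
pose w i := v i - (if i == k then 2 else 0).
have wle i : `|w i| <= 4 * (Q i)^-1.
  have vE : v i = 2 * dist_int (Q i * y) - 2 * dist_int (Q i * z + Q i * y)
      + 2 * dist_int (Q i * z).
    rewrite /v /coboundary /wave add0r mulr0 mulrDr.
    have -> : dist_int (0 : R) = 0 by apply/eqP; rewrite dist_int_eq0 rpred0.
    ring.
  (* For i < k, d_i z is at most 1 / (2 d_i) because d_i^2 <= d_k; for i > k it is an integer and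
     the difference vanishes; for i = k only the error e remains. *)
  have [ik|ki|ik] := ltngtP i k.
  - rewrite /w ltn_eqF// subr0 vE.
    have d1 := dist_int_lip (Q i * y) (Q i * z + Q i * y).
    rewrite opprD addrCA subrr addr0 dist_intN in d1.
    have d2 : dist_int (Q i * z) <= 2^-1 * (Q i)^-1.
      rewrite (le_trans (dist_int_le_norm _))// ger0_norm; last first.
        by rewrite mulr_ge0// invr_ge0 mulr_ge0.
      rewrite /z invfM mulrCA ler_pM2l// ler_pdivrMr ?Q_gt0//.
      rewrite ler_pdivlMl ?Q_gt0// -natrM ler_nat; exact: denom_sq_le.
    have := dist_int_ge0 (Q i * z); have := Qinv_gt0 i.
    move: d1 d2; rewrite !ler_norml => /andP[? ?] ? ? ?.
    by apply/andP; split; lra.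
  - have zi : Q i * z \is a Num.int.
      have /dvdnP[c ->] := denom_dvd ki.
      by rewrite natrM /z (_ : _ * _ = c%:R) ?rpred_nat// natrM; field.
    have z0 : dist_int (Q i * z) = 0 by apply/eqP; rewrite dist_int_eq0.
    rewrite /w gtn_eqF// vE z0 [Q i * z + _]addrC dist_intDint//.
    by rewrite mulr0 !subrr addr0 subrr normr0 mulr_ge0// ltW ?Qinv_gt0.
  rewrite /w vE ik eqxx Qky Qkz dist_int_half.
  have -> : dist_int (2^-1 + (m%:~R + 2^-1 + e)) = dist_int e.
    rewrite -(dist_intDint e (intr_int R (m + 1))) intrD.
    by congr dist_int; field.
  have -> : dist_int (m%:~R + 2^-1 + e) = dist_int (2^-1 + e).
    by rewrite -addrA addrC dist_intDint ?intr_int.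
  have d1 := dist_int_lip (2^-1 + e) 2^-1; rewrite addrAC subrr add0r in d1.
  rewrite dist_int_half in d1.
  have d2 := dist_int_le_norm e; rewrite gtr0_norm// in d2.
  have d3 := dist_int_ge0 e.
  have := Qinv_sq k.+1; have := QinvS k; have := Qinv_gt0 k.+1.
  move: d1; rewrite !ler_norml => /andP[? ?] ? ? ?; apply/andP; split; lra.
have cob t : cvgn (series (coboundary y t)).
  exact: is_cvg_Qseries (coboundary_nat n t).
(* The partial sums of v and w differ by exactly 2 beyond index k. *)
have vw : limn (series v) = limn (series w) + 2.
  apply: cvg_lim => //.
  have : (fun n => series w n + 2) @ \oo --> limn (series w) + 2.
    by apply: cvgD; [exact: is_cvg_Qseries wle | exact: cvg_cst].
  apply: cvg_trans; apply: near_eq_cvg; exists k.+1 => // N /= kN.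
  rewrite /series /= /w sumrB.
  rewrite [X in _ - X + _](_ : _ = 2) ?subrK//.
  rewrite (bigD1_seq k) ?iota_uniq ?mem_index_iota//= eqxx.
  by rewrite big1 ?addr0// => i /negPf ->.
have -> : cocycle_sum n 0 - cocycle_sum n z = limn (series v).
  rewrite /cocycle_sum opprD addrACA subrr add0r.
  by rewrite /transfer -lim_seriesB.
rewrite vw; have := Qseries_le wle; rewrite ler_norml => /andP[? _]; lra.
Qed.

Lemma cocycle_sum_shear k (r : R) : exists n z,
  [/\ (0 < n)%N, `|z| <= (Q k)^-1 &
    cocycle_sum n z - cocycle_sum n 0 - r \is a Num.int].
Proof.
have [n n0 osc] := cocycle_sum_oscillates k; exists n.
(* Then -1 < r + f <= 0, so the target value lies within the drop of at least 1. *)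
pose f := Num.floor (- r).
have := floor_itv (- r); rewrite -/f intrD => /andP[fr rf].
have z0 : 0 <= (2 * Q k)^-1 by rewrite invr_ge0 mulr_ge0.
have fc : {within `[0, (2 * Q k)^-1]%classic, continuous (cocycle_sum n)}.
  by apply: continuous_subspaceT; exact: continuous_cocycle_sum.
have [|z] := @IVT R (cocycle_sum n) _ _ (cocycle_sum n 0 + r + f%:~R) z0 fc.
  rewrite ge_min le_max; apply/andP; split; apply/orP; [right|left]; lra.
rewrite in_itv /= => /andP[z1 z2] zE; exists z; split => //.
  rewrite ger0_norm// (le_trans z2)// lef_pV2 ?posrE ?mulr_gt0 ?Q_gt0//.
  by have := Q_gt0 k; lra.
have -> : cocycle_sum n z - cocycle_sum n 0 - r = f%:~R by rewrite zE; ring.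
exact: intr_int.
Qed.

(** * The cocycle on the circle and its shears *)

Definition circle_cocycle (a : circle R) : circle R :=
  to_circle (cocycle (repr a)).

(** Periodicity of [transfer] makes the lift chosen by [repr] immaterial. *)
Lemma circle_cocycleE x : circle_cocycle (to_circle x) = to_circle (cocycle x).
Proof.
congr to_circle; congr (_ + _); apply: transfer_int.
by rewrite -to_circle_eq /to_circle reprK.
Qed.

Lemma continuous_circle_cocycle : continuous circle_cocycle.
Proof.
apply: metric_continuousP => a e e0; have [x <-] := to_circle_surj a.
have [d d0 dP] := transfer_unif_continuous 1 e0.
exists d => // b; have [y <- <-] := circle_lift x b => /dP.
rewrite mul1r !circle_cocycleE mdist_to_circle => xy.
rewrite (le_lt_trans (dist_int_le_norm _))//.
by rewrite /cocycle opprD addrACA subrr add0r.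
Qed.

Lemma to_circle0 : to_circle (0 : R) = 0.
Proof. exact: raddf0. Qed.

Lemma iter_skew_cocycle n x t :
  (iter n (skew_product (rotation angle) circle_cocycle) (to_circle x, t)).2 =
  t + to_circle (cocycle_sum n x).
Proof.
elim: n => [|n IH].
  by rewrite cocycle_sum0 to_circle0 addr0.
rewrite iterS /= IH iter_skew_product_fst iter_rotation circle_cocycleE.
by rewrite -addrA -to_circleD -cocycle_sumS.
Qed.

Lemma shears_cocycle : shears angle circle_cocycle.
Proof.
move=> s e e0; have [r <-] := to_circle_surj s.
have [k ke] := Qinv_small e0; have [n [z [n0 zk zr]]] := cocycle_sum_shear k r.
exists (to_circle z), n; split => //.
  rewrite -to_circle0 mdist_to_circle sub0r dist_intN.
  exact: le_lt_trans (dist_int_le_norm _) (le_lt_trans zk ke).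
rewrite -[in RHS]to_circle0 !iter_skew_cocycle to_circle0 !add0r -to_circleD.
by apply: to_circle_int; rewrite opprD addrA.
Qed.

(** * Recurrence along the denominators *)

Lemma recurrence_rotation :
  set_of_recurrence (rotation angle) [set denom k | k in [set: nat]].
Proof.
exists (to_circle 0); apply/le_anti/andP; split; last first.
  by apply/ereal_infP => y [n _ <-]; rewrite lee_fin mdist_ge0.
apply/lee_addgt0Pr => e e0; rewrite add0e.
have [k ke] := Qinv_small e0.
apply: le_trans (ereal_inf_lbound _) _.
  by exists (denom k); [exists k | reflexivity].
rewrite lee_fin iter_rotation mdist_to_circle sub0r add0r dist_intN.
have := dist_int_denom_angle k; have := Qinv_sq k; have := Qinv_gt0 k; lra.
Qed.

Lemma no_recurrence_skew : ~ set_of_recurrence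
  (skew_product (rotation angle) circle_cocycle)
  [set denom k | k in [set: nat]].
Proof.
move=> [[a t] inf0].
suff : ((4^-1 : R)%:E <= 0)%E by rewrite lee_fin; lra.
(* The fibre coordinate alone moves by at least 1/4 at every time [denom k], from any starting
   point. *)
rewrite -inf0; apply/ereal_infP => y [n [k _ <-] <-]; rewrite lee_fin.
have [x <-] := to_circle_surj a.
rewrite mdist_torus2 iter_skew_cocycle /=.
rewrite (le_trans (cocycle_sum_denom k x))// -[leLHS]add0r lerD ?mdist_ge0//.
rewrite addrC -[X in mdist X _]add0r mdist_circleD -to_circle0.
by rewrite mdist_to_circle sub0r dist_intN.
Qed.
End liouville.

Theorem theoremB (R : realType) :
  exists (alpha : R) (h : circle R -> circle R),
    let T := rotation alpha in
    let Th := skew_product T h in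
    [/\ irrational alpha,
        continuous h,
        is_system T /\ is_system Th,
        minimal Th /\
          largest_equicontinuous_factor Th T (@torus2_fst R) &
        exists A : set nat,
          [/\ A `<=` posnat,
              set_of_recurrence T A &
              ~ set_of_recurrence Th A]].
Proof.
have hc := @continuous_circle_cocycle R.
have minTh := shears_minimal hc shears_cocycle minimal_rotation.
exists angle, circle_cocycle; split.
- exact: irrational_angle.
- exact: hc.
- by split; [exact: is_system_rotation | exact: is_system_skew_product].
- by split; last exact: shears_largest_factor shears_cocycle minTh.
exists [set denom k | k in [set: nat]]; split.
- by move=> _ [k _ <-]; exact: denom_gt0.
- exact: recurrence_rotation.
- exact: no_recurrence_skew.
Qed.
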